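(* Let $n\ge 2$ and $k\ge 2$ be integers. If $$f\big(\tfrac{n}{q(n,k)}\big)\le \min\big\{p(n),\ 2\lceil n/k\rceil-3\big\},$$ then $$\widehat{\Phi}_k(n)=f\big(\tfrac{n}{q(n,k)}\big).$$
   Context: For an integer $n\ge 2$, $\mathbb{Z}_n$ denotes the additive cyclic group of integers modulo $n$. For $A\subseteq\mathbb{Z}_n$ the restricted self-sumset is $A\widehat{+}A=\{a+a' : a,a'\in A,\ a\ne a'\}\subseteq\mathbb{Z}_n$ (so it is empty, of size $0$, when $|A|\le 1$). A $k$-coloring of $\mathbb{Z}_n$ is a disjoint union $\mathbb{Z}_n=A_1\sqcup\cdots\sqcup A_k$, with color classes $A_i$ (which may be empty). Define $$\widehat{\Phi}_k(n)=\min_{\mathbb{Z}_n=A_1\sqcup\cdots\sqcup A_k}\ \max_{1\le i\le k}|A_i\widehat{+}A_i|,$$ the minimum being over all $k$-colorings of $\mathbb{Z}_n$. For an integer $r\ge 2$, $p(r)$ is the least prime divisor of $r$. $q(n,k)$ is the largest (positive) divisor of $n$ that is at most $k$. The function $f$ on positive integers is $f(1)=0$, $f(2)=1$, and $f(t)=t$ for $t\ge 3$. The quantity $2\lceil n/k\rceil-3$ is an integer and may be negative. *)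

(* Defs.v *)
From HB Require Import structures.
From mathcomp Require Import all_boot all_order all_algebra.

Set Implicit Arguments.
Unset Strict Implicit.
Unset Printing Implicit Defensive.

Import Order.TTheory GRing.Theory Num.Theory.

(* 'Z_n is the group of integers modulo n only for n >= 2. *)
Definition restricted_sumset (n : nat) (A : {set 'Z_n}) : {set 'Z_n} :=
  [set (a + a')%R | a in A, a' in A & a != a'].

Definition is_coloring (n k : nat) (A : {ffun 'I_k -> {set 'Z_n}}) : bool :=
  (\bigcup_(i < k) A i == [set: 'Z_n]) &&
  [forall i, forall j, (i != j) ==> [disjoint A i & A j]].

Definition max_sumset (n k : nat) (A : {ffun 'I_k -> {set 'Z_n}}) : nat :=
  \max_(i < k) #|restricted_sumset (A i)|.

(* The neutral element #|'Z_n| of this minimum bounds every max_sumset A, and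
   a coloring exists as soon as 0 < k, so it does not affect the value: see
   Phi_attained and Phi_le. *)
Definition Phi (k n : nat) : nat :=
  \big[Order.min/#|'Z_n|]_(A : {ffun 'I_k -> {set 'Z_n}} | is_coloring A)
    max_sumset A.

Definition q (n k : nat) : nat := \max_(d <- divisors n | d <= k) d.

(* Only positive arguments are meaningful. *)
Definition f (t : nat) : nat :=
  match t with 1 => 0 | 2 => 1 | _ => t end.

Lemma Phi_le (n k : nat) (A : {ffun 'I_k -> {set 'Z_n}}) :
  is_coloring A -> Phi k n <= max_sumset A.
Proof.
by move=> cA; rewrite -leEnat; exact: bigmin_le_cond.
Qed.

Lemma Phi_attained (n k : nat) : 0 < k ->
  exists2 A : {ffun 'I_k -> {set 'Z_n}},
    is_coloring A & Phi k n = max_sumset A.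
Proof.
case: k => // k _.
pose A0 : {ffun 'I_k.+1 -> {set 'Z_n}} :=
  [ffun i => if i == ord0 then setT else set0].
have cA0 : is_coloring A0.
  apply/andP; split.
    rewrite -subTset; apply/subsetP => x _; apply/bigcupP; exists ord0 => //.
    by rewrite ffunE eqxx inE.
  apply/forallP => i; apply/forallP => j; apply/implyP; rewrite !ffunE -setI_eq0.
  by case: (i =P ord0) => [->|_]; case: (j =P ord0) => [->|_];
    rewrite ?eqxx ?set0I ?setI0.
case: (arg_minnP (@max_sumset n k.+1) cA0) => A cA minA.
exists A => //; apply/eqP; rewrite eqn_leq Phi_le //=.
rewrite /Phi; elim/big_ind: _ => [|x y Ax Ay|B /minA //].
  by apply/bigmax_leqP => i _; exact: max_card.
by rewrite leq_min Ax.
Qed.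

(* Main.v *)
(* Write t = n / q(n,k). Colouring by residues modulo q(n,k) gives classes that
   are cosets of a subgroup of order t, hence the upper bound f(t). For the
   lower bound, some class has at least ceil(n/k) elements, so it suffices to
   know that |A ^+ A| >= min(p(n), 2|A| - 3) in Z_n when p(n) is odd (the case
   p(n) = 2 only leaves f(t) <= 1).

   This bound of Erdos-Heilbronn type holds in every finite abelian group G, as
   long as 2|A| - 3 is at most every prime divisor of |G|. In prime order it is
   the polynomial method. In general, take H < G of prime order, apply
   Cauchy-Davenport and Erdos-Heilbronn to the fibers of A over G/H and the
   induction hypothesis to the image of A in G/H, and add up the numbers of sums
   in the different cosets of H. *)
Require Import Defs.
From mathcomp Require Import all_boot all_order all_algebra.
From mathcomp Require Import all_fingroup all_solvable zify ring.

Set Implicit Arguments.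
Unset Strict Implicit.
Unset Printing Implicit Defensive.

Import Order.TTheory GRing.Theory Num.Theory.

(** * Polynomial method in ['F_p]: Cauchy-Davenport and Erdos-Heilbronn in prime order *)

Section PolynomialMethod.
Local Open Scope ring_scope.

(** Lagrange interpolation at the [a.+1] points of [A] reproduces ['X^i] for [i <= a]; reading off
    its coefficient of degree [a] gives the weights, the inverses of [(L x).[x]]. *)
Lemma top_coef_weights (F : finFieldType) (A : {set F}) a :
  #|A| = a.+1 ->
  exists w : F -> F,
    forall i, (i <= a)%N -> \sum_(x in A) w x * x ^+ i = (i == a)%:R.
Proof.
move=> cA; pose L x : {poly F} := \prod_(y in A :\ x) ('X - y%:P).
have Lroot x y : y \in A -> y != x -> (L x).[y] = 0.
  move=> yA yx; rewrite horner_prod (bigD1 y) /= ?inE ?yx //.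
  by rewrite !hornerE subrr mul0r.
have Lneq0 x : (L x).[x] != 0.
  rewrite horner_prod prodf_seq_neq0; apply/allP => y _; apply/implyP.
  by rewrite !hornerE subr_eq0 eq_sym !inE => /andP[].
have szL x : x \in A -> size (L x) = a.+1.
  move=> xA; rewrite /L -big_enum size_prod_XsubC -cardE.
  by move: cA; rewrite (cardsD1 x) xA add1n => [[->]].
have cL x : x \in A -> (L x)`_a = 1.
  move=> xA; have /eqP := monic_prod_XsubC (index_enum F) [in A :\ x] id.
  by rewrite /lead_coef -/(L x) szL.
exists (fun x => (L x).[x]^-1) => i lei.
(* [D] is the interpolation error: it has [a.+1] roots and size at most [a.+1], hence is zero. *)
pose D := 'X^i - \sum_(x in A) ((L x).[x]^-1 * x ^+ i) *: L x.
have D0 : D = 0.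
  apply: (@roots_geq_poly_eq0 _ _ (enum A)); rewrite ?enum_uniq //.
    apply/allP => y; rewrite mem_enum => yA; rewrite /root /D !hornerE.
    rewrite horner_sum (bigD1 y) //= big1 => [|x /andP[_ xy]].
      by rewrite addr0 !hornerE mulrAC mulVf // mul1r subrr.
    by rewrite hornerZ (Lroot x y) ?mulr0 1?eq_sym.
  rewrite -cardE cA (leq_trans (size_polyD _ _)) // geq_max size_polyXn.
  rewrite ltnS lei.
  rewrite size_polyN (leq_trans (size_sum _ _ _)) //.
  by apply/bigmax_leqP => x xA; rewrite (leq_trans (size_scale_leq _ _)) ?szL.
have := congr1 (fun p : {poly F} => p`_a) D0.
rewrite coef0 coefB coefXn coef_sum => /eqP.
rewrite subr_eq0 eq_sym [a == i]eq_sym.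
by move=> /eqP <-; apply: eq_bigr => x xA; rewrite coefZ cL // mulr1.
Qed.

(* The monomials x^i y^j with i + j <= a + b other than x^a y^b have i < a or
   j < b, so they are killed by the weights. *)
Lemma sum_weights_monic (F : finFieldType) (A B : {set F}) (w w' : F -> F)
    (a b : nat) (P : {poly F}) :
  (forall i, (i <= a)%N -> \sum_(x in A) w x * x ^+ i = (i == a)%:R) ->
  (forall i, (i <= b)%N -> \sum_(x in B) w' x * x ^+ i = (i == b)%:R) ->
  P \is monic -> size P = (a + b).+1 ->
  \sum_(x in A) \sum_(y in B) w x * w' y * P.[x + y] = 'C(a + b, b)%:R.
Proof.
move=> wA wB Pmon szP.
transitivity (\sum_(m < (a + b).+1) \sum_(i < m.+1) P`_m *
    ((\sum_(x in A) w x * x ^+ (m - i)) * (\sum_(y in B) w' y * y ^+ i))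
     *+ 'C(m, i)).
  under eq_bigr => x _ do under eq_bigr => y _ do
    rewrite horner_coef szP mulr_sumr.
  under eq_bigr do rewrite exchange_big /=.
  rewrite exchange_big; apply: eq_bigr => m _ /=.
  under eq_bigr => x _ do under eq_bigr => y _ do
    rewrite exprDn mulrA mulr_sumr.
  under eq_bigr do rewrite exchange_big /=.
  rewrite exchange_big; apply: eq_bigr => i _ /=.
  rewrite mulr_suml mulr_sumr -sumrMnl; apply: eq_bigr => x _.
  rewrite mulr_sumr mulr_sumr -sumrMnl; apply: eq_bigr => y _.
  rewrite -mulrnAr !mulrnAr; congr (_ *+ _).
  by ring.
have moments0 (m : 'I_(a + b).+1) (i : 'I_m.+1) :
    ~~ ((val m == a + b)%N && (val i == b)) ->
    (\sum_(x in A) w x * x ^+ (m - i)) * (\sum_(y in B) w' y * y ^+ i) = 0.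
  have := ltn_ord m; have := ltn_ord i => /= im mab.
  case: (ltnP i b) => [ib _|bi ne].
    by rewrite wB 1?ltnW // (ltn_eqF ib) mulr0.
  have lt : (m - i < a)%N by move: im mab bi ne; clear; lia.
  by rewrite wA 1?ltnW // (ltn_eqF lt) mul0r.
rewrite (bigD1 ord_max) //= [X in _ + X]big1 => [|m mab]; last first.
  apply: big1 => i _; rewrite moments0 ?mulr0 ?mul0rn //.
  by rewrite (_ : (val m == _) = false) //; apply: negbTE; exact: mab.
have bab : (b < (a + b).+1)%N by lia.
rewrite addr0 (bigD1 (Ordinal bab)) //= [X in _ + X]big1 => [|i ib]; last first.
  rewrite (moments0 ord_max) ?mulr0 ?mul0rn //=.
  by rewrite eqxx /=; exact: ib.
rewrite addnK wA // wB // !eqxx addr0 !mulr1.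
by move/eqP: Pmon; rewrite /lead_coef szP => /= ->.
Qed.

Lemma monic_vanishing (F : finFieldType) (S : {set F}) d :
  (#|S| <= d)%N ->
  exists P : {poly F},
    [/\ P \is monic, size P = d.+1 & {in S, forall x, P.[x] = 0}].
Proof.
move=> cS; pose P : {poly F} := \prod_(x in S) ('X - x%:P).
have Pmon : P \is monic := monic_prod_XsubC _ _ _.
have szP : size P = #|S|.+1 by rewrite /P -big_enum size_prod_XsubC -cardE.
(* The power of ['X] raises the degree to exactly [d]. *)
exists ('X^(d - #|S|) * P); split.
- by rewrite monicMr ?monicXn.
- by rewrite size_Mmonic -?size_poly_gt0 ?size_polyXn // szP; lia.
- move=> x xS; rewrite hornerM horner_prod (bigD1 x) //=.
  by rewrite hornerXsubC subrr mul0r mulr0.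
Qed.

(** If [p] divided the binomial coefficient, it would divide [m!], whose factors are all below
    [p]. *)
Lemma bin_Fp_neq0 p m i : prime p -> (i <= m < p)%N -> 'C(m, i)%:R != 0 :> 'F_p.
Proof.
move=> pp /andP[im mp].
rewrite -(GRing.dvdn_pcharf (pchar_Fp pp)).
apply: contraTN mp => pC; rewrite -leqNgt.
have : (p %| m`!)%N by rewrite -(bin_fact im) dvdn_mulr.
elim: m {im pC} => [|m IH]; first by rewrite dvdn1 => /eqP p1; rewrite p1 in pp.
by rewrite factS Euclid_dvdM // => /orP[/dvdn_leq->//|/IH /leqW].
Qed.

(** If the sumset had at most [a + b] elements, a monic polynomial of degree [a + b] would vanish on
    it, and so would the weighted sum; yet that sum is a binomial coefficient, nonzero modulo [p]
    since [a + b < p]. *)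
Lemma Cauchy_Davenport p (A B : {set 'F_p}) :
  prime p -> A != set0 -> B != set0 -> (#|A| + #|B| <= p.+1)%N ->
  (#|A| + #|B| <= #|[set (x + y)%R | x in A, y in B]|.+1)%N.
Proof.
move=> pp; rewrite -!card_gt0; set S := [set _ | _ in _, _ in _].
case cA: #|A| => [//|a]; case cB: #|B| => [//|b] _ _ leab.
rewrite leqNgt; apply/negP => ltS.
have leS : (#|S| <= a + b)%N by move: ltS; clear; lia.
have [P [Pmon szP P0]] := monic_vanishing leS.
have [w wA] := top_coef_weights cA; have [w' wB] := top_coef_weights cB.
have /eqP := sum_weights_monic wA wB Pmon szP.
rewrite big1 => [|x xA]; last first.
  by rewrite big1 // => y yB; rewrite P0 ?mulr0 //; apply/imset2P; exists x y.
rewrite eq_sym; apply/negP; apply: bin_Fp_neq0 => //.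
by rewrite leq_addl; move: leab; clear; lia.
Qed.

(* Alon-Nathanson-Ruzsa: apply the weights of A and of A minus a point to
   (x - y) P(x + y), which vanishes on the product of these two sets; the
   relevant coefficient is a Catalan number. *)
Lemma Erdos_Heilbronn_Fp p (A : {set 'F_p}) :
  prime p -> (#|A|.*2 <= p + 3)%N ->
  (#|A|.*2 <= #|[set (x + y)%R | x in A, y in A & x != y]| + 3)%N.
Proof.
move=> pp leA; set S := imset2 _ _ _.
have [k2|] := leqP #|A| 2.
  have [|k1] := leqP #|A| 1; first by lia.
  have /card_gt1P[x [y [xA yA xy]]] := k1.
  suff : (0 < #|S|)%N by lia.
  apply/card_gt0P; exists (x + y); apply/imset2P.
  by exists x y; rewrite // inE yA.
case cA: #|A| => [//|[//|[//|m]]] _; rewrite cA in leA.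
rewrite leqNgt; apply/negP => ltS.
have leS : (#|S| <= m.+1 + m.+1)%N by move: ltS; clear; lia.
have [P [Pmon szP P0]] := monic_vanishing leS.
have /card_gt0P[z zA] : (0 < #|A|)%N by rewrite cA.
pose B := A :\ z.
have cB : #|B| = m.+2 by move: cA; rewrite (cardsD1 z) zA add1n => [[]].
have [w wA] := top_coef_weights cA; have [w' wB] := top_coef_weights cB.
(* Absorbing the factor [x] into the weights lowers by one the degree they extract. The two terms of
   [(x - y) P(x + y)] thus give binomial coefficients with lower indices [m.+1] and [m]. *)
have wA1 i : (i <= m.+1)%N -> \sum_(x in A) (w x * x) * x ^+ i = (i == m.+1)%:R.
  move=> im; rewrite -[i == _]/(i.+1 == m.+2) -wA //.
  by apply: eq_bigr => x _; rewrite exprS mulrA.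
have wB1 i : (i <= m)%N -> \sum_(x in B) (w' x * x) * x ^+ i = (i == m)%:R.
  move=> im; rewrite -[i == _]/(i.+1 == m.+1) -wB //.
  by apply: eq_bigr => x _; rewrite exprS mulrA.
have E1 := sum_weights_monic wA1 wB Pmon szP.
have szP' : size P = (m.+2 + m).+1 by rewrite szP (addSnnS m.+1).
have E2 := sum_weights_monic wA wB1 Pmon szP'.
have : 'C(m.+2 + m, m)%:R = 'C(m.+1 + m.+1, m.+1)%:R :> 'F_p.
  rewrite -E1 -E2; apply: eq_bigr => x xA; apply: eq_bigr => y.
  rewrite inE => /andP[_ yA]; have [->|xy] := eqVneq x y.
    by ring.
  by rewrite P0 ?mulr0 //; apply/imset2P; exists x y; rewrite // inE yA.
rewrite (addSnnS m.+1) => Ceq.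
(* Since [m.+1 * 'C(2m+2, m.+1) = m.+2 * 'C(2m+2, m)], equality of the two coefficients forces
   ['C(2m+2, m)] to vanish modulo [p], although [2m+2 < p]. *)
have := mul_bin_left (m.+1 + m.+1) m.
move=> /(congr1 (fun n : nat => n%:R : 'F_p)); rewrite !natrM Ceq => /eqP.
rewrite -subr_eq0 -mulrBl mulf_eq0 (negPf (bin_Fp_neq0 pp _)); last first.
  by rewrite leq_addl; move: leA; clear; lia.
rewrite orbF (_ : (m.+1 + m.+1 - m)%N = m.+2); last by lia.
by rewrite [m.+2%:R]mulrS opprD addrCA subrr addr0 oppr_eq0 oner_eq0.
Qed.
End PolynomialMethod.

(** * Restricted products in finite groups *)

Section RestrictedProducts.
Local Open Scope group_scope.

(* Convertible to restricted_sumset A when gT is 'Z_n. *)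
Definition restricted_product (gT : finGroupType) (A : {set gT}) : {set gT} :=
  [set a * b | a in A, b in A & a != b].

Lemma mem_restricted_product (gT : finGroupType) (A : {set gT}) a b :
  a \in A -> b \in A -> a != b -> a * b \in restricted_product A.
Proof. by move=> aA bA ab; apply/imset2P; exists a b; rewrite // inE bA. Qed.

Lemma restricted_productS (gT : finGroupType) (A B : {set gT}) :
  A \subset B -> restricted_product A \subset restricted_product B.
Proof.
move=> /subsetP AB; apply/subsetP => _ /imset2P[a b aA + ->]; rewrite inE.
by move=> /andP[bA ab]; apply: mem_restricted_product; rewrite ?AB.
Qed.

Lemma sum_card_fibers (T S : finType) (X : {set T}) (phi : T -> S)
    (E : {set S}) :
  \sum_(c in E) #|X :&: phi @^-1: [set c]| <= #|X|.
Proof.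
rewrite -[leqRHS]sum1_card (bigID (fun x => phi x \in E)) /=.
rewrite (partition_big phi (mem E)) /= => [|x /andP[]//].
rewrite (leq_trans _ (leq_addr _ _)) //; apply: leq_sum => c cE.
rewrite sum1dep_card subset_leq_card //; apply/subsetP => x.
by rewrite !inE => /andP[-> /eqP->]; rewrite cE eqxx.
Qed.

(** * Lifting the bound from the fibers and the image of a morphism *)

Section Extension.
Variables (gT hT : finGroupType) (phi : gT -> hT) (A : {set gT}).
Let fiber u := A :&: phi @^-1: [set u].
Let U := phi @: A.
Let D := restricted_product U.
Let k u := #|fiber u|.
Let N c := #|restricted_product A :&: phi @^-1: [set c]|.

(** In the application [phi] is the quotient by a subgroup of prime order: [square_inj] comes from
    odd order, [fiberM] from Cauchy-Davenport, [fiber_square] from the prime case and [image_square]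
    from induction. *)
Hypothesis phiM : {in A &, {morph phi : a b / a * b}}.
Hypothesis square_inj : {in U &, injective (fun u => u * u)}.
Hypothesis fiberM :
  {in U &, forall u v, u != v -> k u + k v <= #|fiber u * fiber v|.+1}.
Hypothesis fiber_square :
  {in U, forall u, (k u).*2 <= #|restricted_product (fiber u)| + 3}.
Hypothesis image_square : #|U|.*2 <= #|D| + 3.

Let k_gt0 u : u \in U -> 0 < k u.
Proof.
by case/imsetP => a aA ->; apply/card_gt0P; exists a; rewrite !inE aA eqxx.
Qed.

Let sum_k : \sum_(u in U) k u = #|A|.
Proof.
rewrite -[RHS]sum1_card (partition_big phi (mem U)) /= => [|a aA]; last first.
  exact: imset_f.
apply: eq_bigr => u _; rewrite sum1dep_card.
by apply: eq_card => a; rewrite !inE.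
Qed.

(** Elements lying over distinct [u] and [v] are distinct, so the whole product of the two fibers
    consists of restricted products. *)
Let NM u v : u \in U -> v \in U -> u != v -> k u + k v <= (N (u * v)).+1.
Proof.
move=> uU vU uv; apply: leq_trans (fiberM uU vU uv) _; rewrite ltnS.
apply/subset_leq_card/subsetP => _ /mulsgP[a b + + ->]; rewrite !inE.
move=> /andP[aA /eqP au] /andP[bA /eqP bv]; rewrite phiM // au bv eqxx andbT.
apply: mem_restricted_product => //; apply: contraNneq uv => ab.
by rewrite -au -bv ab.
Qed.

Let N_square u : u \in U -> (k u).*2 <= N (u * u) + 3.
Proof.
move=> uU; apply: leq_trans (fiber_square uU) _; rewrite leq_add2r.
apply/subset_leq_card/subsetP => _ /imset2P[a b + + ->]; rewrite !inE.
move=> /andP[aA /eqP au] /andP[/andP[bA /eqP bu] ab].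
by rewrite phiM // au bu eqxx andbT; apply: mem_restricted_product.
Qed.

Let N_gt0 c : c \in D -> 0 < N c.
Proof.
case/imset2P => u v uU + ->; rewrite inE => /andP[vU uv].
by have := NM uU vU uv; have := k_gt0 uU; have := k_gt0 vU; lia.
Qed.

Let sum_ge1 (E : {set hT}) : E \subset D -> #|E| <= \sum_(c in E) N c.
Proof.
move=> /subsetP ED; rewrite -sum1_card leq_sum // => c /ED; exact: N_gt0.
Qed.

Section MaximalFiber.
Variable u1 : hT.
Hypotheses (u1U : u1 \in U) (maxk : {in U, forall u, k u <= k u1}).
Let l := k u1.
Let T := [set u1 * v | v in U :\ u1].

Let cardT : #|T| = #|U|.-1.
Proof. by rewrite card_imset; [rewrite (cardsD1 u1 U) u1U | exact: mulgI]. Qed.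

Let subTD : T \subset D.
Proof.
apply/subsetP => _ /imsetP[v + ->]; rewrite !inE eq_sym => /andP[vu vU].
exact: mem_restricted_product.
Qed.

(** Sum over [v] of the bounds [l + k v - 1] given by [NM] on the cosets [u1 * v]. *)
Let sumT : #|U|.-1 * l + #|A| <= \sum_(c in T) N c + l + #|U|.-1.
Proof.
rewrite -sum_k (big_setD1 u1) //= big_imset /=; last by move=> ? ? _ _ /mulgI.
have -> : #|U|.-1 = #|U :\ u1| by rewrite (cardsD1 u1 U) u1U.
rewrite addnCA -/l addnAC [_ + l]addnC leq_add2l.
rewrite -sum_nat_const -sum1_card -!big_split /=; apply: leq_sum => v.
by rewrite !inE eq_sym => /andP[vu vU]; rewrite addn1 NM.
Qed.

(* k u + k v falls short of 2 l by at most |U| l - |A|; moved around so that no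
   truncated subtraction of cardinals of A occurs. *)
Let deficit u v : u \in U -> v \in U -> u != v ->
  #|A| <= k u + k v + (#|U| - 2) * l.
Proof.
move=> uU vU uv; rewrite -sum_k (big_setD1 u) //= (big_setD1 v) /=; last first.
  by rewrite !inE eq_sym uv.
rewrite addnA leq_add2l.
have -> : #|U| - 2 = #|(U :\ u) :\ v|.
  rewrite (cardsD1 u U) uU (cardsD1 v (U :\ u)) !inE eq_sym uv vU.
  by rewrite !add1n subn2.
rewrite -sum_nat_const; apply: leq_sum => w.
by rewrite !inE => /and3P[_ _ wU]; exact: maxk.
Qed.

Let sumD : \sum_(c in T) N c + \sum_(c in D :\: T) N c = \sum_(c in D) N c.
Proof.
by rewrite [RHS](big_setID T) /= (setIidPr subTD).
Qed.

Lemma card_le_max_fiber : #|A| <= #|U| * k u1.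
Proof.
by rewrite -sum_k -sum_nat_const leq_sum // => u uU; exact: maxk.
Qed.

(** [T] takes [|U| - 1] of the at least [2|U| - 3] cosets in [D]. *)
Let cardDT : #|U| <= #|D :\: T| + 2.
Proof.
move: image_square; rewrite cardsD (setIidPr subTD) cardT.
have : 0 < #|U| by apply/card_gt0P; exists u1.
by move: #|U| #|D| => s d; lia.
Qed.

(* As u1 * u1 = u * v with u != v, its coset contains k u + k v - 1 sums by
   Cauchy-Davenport, which beats the 2 l - 3 coming from the fiber of u1. *)
Lemma extension_square_in :
  u1 * u1 \in D -> #|A|.*2 <= #|restricted_product A| + 3.
Proof.
move=> sqD; have sqDT : u1 * u1 \in D :\: T.
  rewrite inE sqD andbT; apply/imsetP => -[v + /mulgI uv].
  by rewrite -uv !inE eqxx.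
have sumDT : N (u1 * u1) + #|D :\: T| <= (\sum_(c in D :\: T) N c).+1.
  rewrite (big_setD1 _ sqDT) /= [#|_|](cardsD1 (u1 * u1)) sqDT add1n addnS ltnS.
  by rewrite leq_add2l sum_ge1 // (subset_trans (subsetDl _ _)) // subsetDl.
have := sum_card_fibers (restricted_product A) phi D; rewrite -/N -sumD.
case/imset2P: sqD => u v uU + sq; rewrite inE => /andP[vU uv].
have := NM uU vU uv; rewrite -sq; have := deficit uU vU uv.
have : 1 < #|U| by apply/card_gt1P; exists u, v.
move: sumDT sumT cardDT; case: #|U| => [//|[//|s]] /=.
by rewrite subn2 /= mulSn; lia.
Qed.

(** The coset of [u1 * u1] adds [2l - 3] sums to those over [T], and [D :\: T] adds at least
    [|U| - 2]. The total is at least [|A| + |U| l - 4], and the strict inequality supplies the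
    missing unit. *)
Lemma extension_square_notin :
  u1 * u1 \notin D -> #|A| < #|U| * l ->
  #|A|.*2 <= #|restricted_product A| + 3.
Proof.
move=> sqD lA.
have := sum_card_fibers (restricted_product A) phi (u1 * u1 |: D).
rewrite (big_setU1 _ sqD) /= -/(N _) -sumD.
have := sum_ge1 (subsetDl D T); have := N_square u1U.
have : 0 < #|U| by apply/card_gt0P; exists u1.
move: lA sumT cardDT; rewrite -/l; case: #|U| => [//|s] /=.
by rewrite mulSn; move: l (N (u1 * u1)) => m n; lia.
Qed.

(* The squares are |U| distinct cosets outside D, by injectivity of squaring. *)
Lemma extension_constant :
  1 < #|U| -> 1 < l -> {in U, forall u, k u = l} ->
  {in U, forall u, u * u \notin D} ->
  #|A|.*2 <= #|restricted_product A| + 3.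
Proof.
move=> U1 l1 kl sqD; pose Q := [set u * u | u in U].
have := sum_card_fibers (restricted_product A) phi (D :|: Q); rewrite -/N.
have DQ : [disjoint D & Q].
  rewrite disjoint_sym; apply/pred0P => c; apply/negbTE/negP => /=.
  by move=> /andP[/imsetP[u uU ->]]; apply/negP/sqD.
rewrite (eq_bigl [predU D & Q]) => [|c]; last by rewrite !inE.
rewrite bigU //=; have : #|D| * (l.*2).-1 <= \sum_(c in D) N c.
  rewrite -sum_nat_const leq_sum // => _ /imset2P[u v uU + ->].
  rewrite inE => /andP[vU uv]; have := NM uU vU uv; rewrite !kl //; lia.
have : #|U| * (l.*2 - 3) <= \sum_(c in Q) N c.
  rewrite big_imset //= -sum_nat_const leq_sum // => u uU.
  by have := N_square uU; rewrite kl //; lia.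
have -> : #|A| = (#|U| * l)%N.
  rewrite -sum_k -sum_nat_const; apply: eq_bigr => u uU.
  exact: kl.
move: image_square U1 l1; move: #|U| #|D| l => s d m.
case: s => [//|[//|s]]; case: m => [//|[//|m]] sd _ _.
have -> : (m.+2.*2).-1 = m.*2 + 3 by lia.
have -> : m.+2.*2 - 3 = m.*2 + 1 by lia.
(* Now [|U| = s + 2] and [l = m + 2]: at least [2s + 1] cosets in [D] carry [2m + 3] sums each, and
   the [s + 2] squares carry [2m + 1] each. *)
have : (s.*2 + 1) * (m.*2 + 3) <= d * (m.*2 + 3) by rewrite leq_mul2r; lia.
have : (s.+2 * m.+2).*2 <= (s.*2 + 1) * (m.*2 + 3) + s.+2 * (m.*2 + 1) + 3.
  by clear; nia.
move: (\sum_(c in D) N c) (\sum_(c in Q) N c) #|restricted_product A|.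
by clear; lia.
Qed.
End MaximalFiber.

(** Cases: a single fiber; singleton fibers; a fiber of maximal size whose square is in [D]; fibers
    of unequal size; equal fibers with no square in [D]. *)
Lemma restricted_product_extension : #|A|.*2 <= #|restricted_product A| + 3.
Proof.
have [->|/set0Pn[a0 a0A]] := eqVneq A set0; first by rewrite cards0.
have u0U : phi a0 \in U by exact: imset_f.
have [u1 u1U maxk] := arg_maxnP k u0U.
have {}maxk : {in U, forall u, k u <= k u1} by move=> u /maxk.
have leA := card_le_max_fiber maxk.
have [s1|s1] := leqP #|U| 1.
  have := sum_card_fibers (restricted_product A) phi [set u1 * u1].
  rewrite big_set1 -/(N _); have := N_square u1U.
  have : #|U| * k u1 <= k u1 by rewrite -[leqRHS]mul1n leq_mul2r s1 orbT.
  by move: leA; move: (N _) (k _) (#|U| * _)%N => a b c; clear; lia.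
have [l1|l1] := leqP (k u1) 1.
  have := sum_card_fibers (restricted_product A) phi D; rewrite -/N.
  have := sum_ge1 (subxx D); move: image_square.
  have : #|U| * k u1 <= #|U| by rewrite -[leqRHS]muln1 leq_mul2l l1 orbT.
  by move: leA; move: (\sum_(c in D) N c) (#|U| * _)%N => a b; clear; lia.
have [/exists_inP[u uU /andP[/eqP ku sq]]|noD] :=
    boolP [exists u in U, (k u == k u1) && (u * u \in D)].
  by apply: (extension_square_in uU) => // v /maxk; rewrite ku.
have sqD u : u \in U -> k u = k u1 -> u * u \notin D.
  move=> uU ku; apply: contra noD => sq; apply/exists_inP.
  by exists u; rewrite // ku eqxx.
have [/exists_inP[u uU ku]|noku] := boolP [exists u in U, k u < k u1].
  apply: (extension_square_notin u1U) => //; first exact: sqD.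
  rewrite -sum_k -sum_nat_const (big_setD1 u) //= [ltnRHS](big_setD1 u) //=.
  by rewrite -addSn leq_add // leq_sum // => v; rewrite inE => /andP[_ /maxk].
have kl : {in U, forall u, k u = k u1}.
  move=> u uU; apply/eqP; rewrite eqn_leq maxk // leqNgt.
  by apply: contra noku => ku; apply/exists_inP; exists u.
by apply: (extension_constant u1U s1 l1 kl) => u uU; rewrite sqD // kl.
Qed.
End Extension.
End RestrictedProducts.

(** * Transfer from ['F_p] to cosets of a subgroup of prime order *)

Section PrimeCosets.
Local Open Scope group_scope.
Variables (gT : finGroupType) (h : gT) (p : nat).
Hypotheses (p_pr : prime p) (oh : #[h] = p).

Let expgFpD (i j : 'F_p) : h ^+ (i + j)%R = h ^+ i * h ^+ j.
Proof.
(* Addition in ['F_p] reduces modulo a number that is equal to [p] only through [Fp_cast], hence the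
   generalization to [d]. *)
suff E d : d = p -> h ^+ ((i + j) %% d) = h ^+ i * h ^+ j.
  exact: E _ (Fp_cast p_pr).
have hp : h ^+ p = 1 by rewrite -oh expg_order.
by move->; rewrite expg_mod // expgD.
Qed.

Let expgFp_inj : injective (fun i : 'F_p => h ^+ i).
Proof.
have ltp (i : 'F_p) : i < p by apply: leq_trans (ltn_ord i) _; rewrite Fp_cast.
move=> i j /= /eqP; rewrite eq_expg_mod_order oh !modn_small //.
by move/eqP/val_inj.
Qed.

(** Parametrization of the coset [<[h]> :* x] by ['F_p]. *)
Let point x (i : 'F_p) := h ^+ i * x.

Let point_inj x : injective (point x).
Proof. by move=> i j /mulIg /expgFp_inj. Qed.

Let preim_point x (A : {set gT}) :
  A \subset <[h]> :* x -> point x @: (point x @^-1: A) = A.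
Proof.
move=> /subsetP Ax; apply/setP => a; apply/imsetP/idP => [[i + ->]|aA].
  by rewrite inE.
have /rcosetP[_ /cycleP[m ->] am] := Ax _ aA.
have mE : a = point x (m%:R)%R.
  by rewrite am /point val_Fp_nat // -{1}oh expg_mod_order.
by exists (m%:R)%R; rewrite // inE -mE.
Qed.

Let card_point x (S : {set 'F_p}) : #|point x @: S| = #|S|.
Proof. by rewrite card_imset //; exact: point_inj. Qed.

(** As [x] commutes with [h], [point x i * point y j = point (x * y) (i + j)], so products of points
    follow sums in ['F_p]. *)
Lemma Cauchy_Davenport_cosets (x y : gT) (A B : {set gT}) :
  commute x h -> A \subset <[h]> :* x -> B \subset <[h]> :* y ->
  A != set0 -> B != set0 -> #|A| + #|B| <= p.+1 ->
  #|A| + #|B| <= #|A * B|.+1.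
Proof.
move=> cxh /preim_point eA /preim_point eB.
set S := _ @^-1: A in eA; set T := _ @^-1: B in eB.
rewrite -eA -eB !card_point => S0 T0 leST.
have nz z (X : {set 'F_p}) : point z @: X != set0 -> X != set0.
  by apply: contraNneq => ->; rewrite imset0.
apply: leq_trans (Cauchy_Davenport p_pr (nz _ _ S0) (nz _ _ T0) leST) _.
rewrite ltnS -(card_point (x * y)); apply/subset_leq_card/subsetP.
move=> _ /imsetP[_ /imset2P[i j iS jT ->] ->]; apply/mulsgP.
exists (point x i) (point y j); rewrite ?imset_f //.
rewrite /point expgFpD !mulgA; congr (_ * _); rewrite -!mulgA; congr (_ * _).
exact/commute_sym/commuteX.
Qed.

Lemma Erdos_Heilbronn_coset (x : gT) (A : {set gT}) :
  commute x h -> A \subset <[h]> :* x -> #|A|.*2 <= p + 3 ->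
  #|A|.*2 <= #|restricted_product A| + 3.
Proof.
move=> cxh /preim_point eA; set S := _ @^-1: A in eA.
rewrite -eA card_point => leS.
apply: leq_trans (Erdos_Heilbronn_Fp p_pr leS) _.
rewrite leq_add2r -(card_point (x * x)); apply/subset_leq_card/subsetP.
move=> _ /imsetP[_ /imset2P[i j iS + ->] ->]; rewrite inE => /andP[jS ij].
have -> : point (x * x) (i + j)%R = point x i * point x j.
  rewrite /point expgFpD !mulgA; congr (_ * _); rewrite -!mulgA; congr (_ * _).
  exact/commute_sym/commuteX.
by apply: mem_restricted_product; rewrite ?imset_f // (inj_eq (@point_inj x)).
Qed.
End PrimeCosets.

(** * The Erdos-Heilbronn bound in abelian groups *)

Section AbelianGroups.
Local Open Scope group_scope.

Lemma restricted_product_gt0 (gT : finGroupType) (A : {set gT}) :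
  1 < #|A| -> 0 < #|restricted_product A|.
Proof.
case/card_gt1P => a [b [aA bA ab]]; apply/card_gt0P; exists (a * b).
exact: mem_restricted_product.
Qed.

Lemma Erdos_Heilbronn_abelian (gT : finGroupType) (G : {group gT})
    (A : {set gT}) :
  abelian G -> A \subset G ->
  (forall p, prime p -> p %| #|G| -> #|A|.*2 <= p + 3) ->
  #|A|.*2 <= #|restricted_product A| + 3.
Proof.
have [m] := ubnP #|G|; elim: m => // m IH in gT G A * => ltG abG AG leA.
have [A2|A3] := leqP #|A| 2.
  have [A1|/restricted_product_gt0] := leqP #|A| 1.
    by move: A1; clear; lia.
  by move: A2; clear; lia.
have G1 : 1 < #|G| by apply: leq_trans (subset_leq_card AG); exact: ltnW.
(* For [|A| >= 3] the hypothesis fails at the prime 2, so 2 does not divide the order. *)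
have oddG : odd #|G|.
  rewrite -[odd _]negbK -dvdn2; apply: contraL A3 => /(leA 2 isT).
  by clear; lia.
set p := pdiv #|G|; have p_pr : prime p by exact: pdiv_prime.
have [h hG oh] := Cauchy p_pr (pdiv_dvd _).
have leAp := leA _ p_pr (pdiv_dvd _).
pose H := <[h]>%G; have HG : H \subset G by rewrite cycle_subG.
have nHG : G \subset 'N(H) := sub_abelian_norm abG HG.
have nHA := subset_trans AG nHG.
have cAh a : a \in A -> commute a h.
  by move=> /(subsetP AG) aG; exact: (centsP abG).
have UG : coset H @: A \subset G / H.
  by apply/subsetP => _ /imsetP[a aA ->]; rewrite mem_quotient // (subsetP AG).
have fiberE u a : a \in A :&: coset H @^-1: [set u] ->
    A :&: coset H @^-1: [set u] \subset H :* a.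
  rewrite !inE => /andP[aA /eqP au]; apply/subsetP => b.
  rewrite !inE => /andP[bA /eqP bu].
  by apply/rcoset_kercosetP; rewrite ?(subsetP nHA) // bu.
have fiber_neq0 u : u \in coset H @: A ->
    {a | a \in A :&: coset H @^-1: [set u]}.
  move=> uU; apply/sigW; case/imsetP: uU => a aA ->.
  by exists a; rewrite !inE aA eqxx.
apply: (@restricted_product_extension _ _ (coset H)).
- by move=> a b aA bA; rewrite morphM // (subsetP nHA).
- have coG : coprime #|G / H| 2.
    by rewrite coprimen2 (dvdn_odd (dvdn_quotient _ _)).
  move=> u v /(subsetP UG) uG /(subsetP UG) vG.
  exact: (can_in_inj (expgK coG)).
- move=> u v /fiber_neq0[a aF] /fiber_neq0[b bF] uv.
  have aA : a \in A by case/setIP: aF.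
  apply: (Cauchy_Davenport_cosets p_pr oh (cAh _ aA) (fiberE _ _ aF)
                                  (fiberE _ _ bF)).
  + by apply/set0Pn; exists a.
  + by apply/set0Pn; exists b.
  (* Two distinct fibers are disjoint, so their sizes add up to at most [|A|], within the range of
     Cauchy-Davenport. *)
  have leAp1 : #|A| <= p.+1 by have := prime_gt1 p_pr; move: leAp; clear; lia.
  apply: leq_trans leAp1.
  apply: leq_trans (sum_card_fibers A (coset H) [set u; v]).
  by rewrite big_setU1 ?inE //= big_set1.
- move=> u /fiber_neq0[a aF].
  have aA : a \in A by case/setIP: aF.
  apply: (Erdos_Heilbronn_coset p_pr oh (cAh _ aA) (fiberE _ _ aF)).
  by apply: leq_trans leAp; rewrite leq_double subset_leq_card // subsetIl.
- apply: IH UG _; [|exact: quotient_abelian|].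
    rewrite ltnS in ltG; apply: leq_trans ltG; rewrite ltn_quotient //.
    by rewrite -cardG_gt1 -orderE oh prime_gt1.
  move=> r r_pr rGH.
  apply: leq_trans (leA r r_pr (dvdn_trans rGH (dvdn_quotient _ _))).
  by rewrite leq_double leq_imset_card.
Qed.
End AbelianGroups.

(** * Bounds in ['Z_n]: large classes and residue colorings *)

Section CyclicGroups.

Lemma exists_subset_card (T : finType) (A : {set T}) m :
  m <= #|A| -> exists2 B : {set T}, B \subset A & #|B| = m.
Proof.
move=> mA; exists [set x in take m (enum A)].
  by apply/subsetP => x; rewrite inE => /mem_take; rewrite mem_enum.
rewrite cardsE (card_uniqP _) ?take_uniq ?enum_uniq // size_takel //.
by rewrite -cardE.
Qed.

Lemma restricted_sumset_lower n (A : {set 'Z_n}) :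
  1 < n -> 2 < pdiv n ->
  minn (pdiv n) (#|A|.*2 - 3) <= #|restricted_sumset A|.
Proof.
move=> n1 p3; set p := pdiv n.
have p_odd : odd p.
  by case: (even_prime (pdiv_prime n1)) => // p2; rewrite p2 in p3.
(* Shrinking [A] to at most [(p + 3) / 2] elements meets the size hypothesis; as [p] is odd, a set
   of exactly that size already yields [p] sums. *)
have [|B BA cB] := @exists_subset_card _ A (minn #|A| (p + 3)./2).
  exact: geq_minl.
have leB : #|B|.*2 <= p + 3 by move: cB; clear; lia.
have leBA : #|restricted_sumset B| <= #|restricted_sumset A|.
  exact: subset_leq_card (restricted_productS BA).
have : #|B|.*2 <= #|restricted_sumset B| + 3.
  apply: (@Erdos_Heilbronn_abelian _ [set: 'Z_n]%G) => [||r r_pr].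
  - exact: FinRing.zmod_abelian.
  - exact: subsetT.
  rewrite cardsT card_ord Zp_cast // => /(pdiv_min_dvd (prime_gt1 r_pr)) pr.
  by apply: leq_trans leB _; rewrite leq_add2r.
by move: p3 p_odd cB leBA; rewrite -/p; clear; lia.
Qed.

Lemma restricted_sumset_card_le1 n (A : {set 'Z_n}) :
  #|A| <= 1 -> restricted_sumset A = set0.
Proof.
move=> /card_le1_eqP A1; apply/setP => z; rewrite inE; apply/imset2P.
by case=> a b aA; rewrite inE => /andP[bA /eqP[]]; exact: A1.
Qed.

Lemma restricted_sumset_card2 n (A : {set 'Z_n}) :
  #|A| = 2 -> #|restricted_sumset A| <= 1.
Proof.
move=> /eqP/cards2P[a [b [_ ->]]]; rewrite -(cards1 (a + b)%R).
apply/subset_leq_card/subsetP => _ /imset2P[x y + + ->]; rewrite !inE.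
by move=> /orP[]/eqP-> /andP[/orP[]/eqP->]; rewrite ?eqxx // addrC.
Qed.

(** [j] is not reduced modulo [d], so sums of two elements lie directly in the class of [j + j]. *)
Definition residue_class n d j : {set 'Z_n} := [set x : 'Z_n | x == j %[mod d]].

Lemma card_residue_class n d j :
  1 < n -> d %| n -> #|residue_class n d j| <= n %/ d.
Proof.
case: n => [|[|n]] // _ dn; have d0 : 0 < d by exact: dvdn_gt0 dn.
pose g (i : 'I_(n.+2 %/ d)) : 'Z_n.+2 := inZp (j %% d + i * d).
rewrite -[leqRHS]card_ord -(cardsT 'I_(_)).
rewrite (leq_trans _ (leq_imset_card g _)) //.
apply/subset_leq_card/subsetP => x; rewrite inE => /eqP xj.
have xd : x %/ d < n.+2 %/ d by rewrite ltn_divLR // divnK // ltn_ord.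
apply/imsetP; exists (Ordinal xd) => //; apply: val_inj => /=.
by rewrite -xj addnC -divn_eq modn_small // ltn_ord.
Qed.

Lemma restricted_sumset_residue_class n d j :
  1 < n -> d %| n ->
  restricted_sumset (residue_class n d j) \subset residue_class n d (j + j).
Proof.
case: n => [|[|n]] // _ dn; apply/subsetP => _ /imset2P[x y + + ->].
rewrite !inE => /eqP xj /andP[/eqP yj _] /=.
by rewrite modn_dvdm // -modnDm xj yj modnDm.
Qed.

(** The exceptional values of [f] arise here: a singleton has no restricted sum and a pair has only
    one. *)
Lemma card_restricted_sumset_residue_class n d j :
  1 < n -> d %| n -> #|restricted_sumset (residue_class n d j)| <= f (n %/ d).
Proof.
move=> n1 dn; have cC := card_residue_class _ n1 dn.
have := subset_leq_card (restricted_sumset_residue_class j n1 dn).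
move=> /leq_trans /(_ (cC _)).
move: (cC j); case: (n %/ d) => [|[|[|t]]] //=.
  by move=> c1; rewrite restricted_sumset_card_le1 ?cards0.
rewrite leq_eqVlt => /orP[/eqP c2 _|c1 _]; first exact: restricted_sumset_card2.
by rewrite restricted_sumset_card_le1 ?cards0.
Qed.

Lemma Phi_upper n k d :
  1 < n -> d %| n -> d <= k -> Phi k n <= f (n %/ d).
Proof.
move=> n1 dn dk; have d0 : 0 < d by apply: dvdn_gt0 dn; exact: ltnW.
pose C : {ffun 'I_k -> {set 'Z_n}} :=
  [ffun i : 'I_k => if i < d then residue_class n d i else set0].
have cC : is_coloring C.
  apply/andP; split.
    rewrite -subTset; apply/subsetP => x _; apply/bigcupP.
    have xk : x %% d < k by rewrite (leq_trans _ dk) // ltn_mod.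
    exists (Ordinal xk) => //.
    by rewrite ffunE /= ltn_mod d0 inE modn_mod.
  apply/forallP => i; apply/forallP => j; apply/implyP => ij; rewrite !ffunE.
  case: ifP => [id|_]; last by rewrite -setI_eq0 set0I.
  case: ifP => [jd|_]; last by rewrite -setI_eq0 setI0.
  apply/pred0P => x; rewrite /= !inE !(modn_small id, modn_small jd).
  apply: contraNF ij => /andP[/eqP xi /eqP xj].
  by apply/eqP/val_inj; rewrite /= -xi.
apply: leq_trans (Phi_le cC) _; apply/bigmax_leqP => i _; rewrite ffunE.
case: ifP => _; first exact: card_restricted_sumset_residue_class.
by rewrite restricted_sumset_card_le1 ?cards0.
Qed.

(** Pigeonhole, in product form to avoid the ceiling. *)
Lemma coloring_large_class n k (A : {ffun 'I_k -> {set 'Z_n}}) :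
  1 < n -> 0 < k -> is_coloring A -> exists i, n <= #|A i| * k.
Proof.
move=> n1; case: k A => // k A _ /andP[/eqP covA _].
have [i _ maxA] := arg_maxnP (fun i => #|A i|) (erefl : xpredT (@ord0 k)).
exists i; have leT : n <= #|[set: 'Z_n]| by rewrite cardsT card_ord Zp_cast.
apply: leq_trans leT _.
rewrite -covA; apply: (@leq_trans (\sum_(j < k.+1) #|A j|)).
  elim/big_ind2: _ => [|s X t Y Xs Yt|//]; first by rewrite cards0.
  by rewrite (leq_trans (leq_card_setU X Y)) // leq_add.
rewrite -[X in _ * X]card_ord mulnC -sum_nat_const; apply: leq_sum => j _.
exact: maxA.
Qed.

Lemma q_dvdn_leq n k : 0 < n -> 0 < k -> (q n k %| n) && (q n k <= k).
Proof.
move=> n0 k0; have : 0 < q n k.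
  by rewrite /q (@leq_bigmax_seq _ _ _ id 1) // -dvdn_divisors // dvd1n.
(* The value 0 is the default of an empty maximum; the divisor 1 excludes it. *)
suff [->//|//] : q n k = 0 \/ (q n k %| n) && (q n k <= k).
rewrite /q big_seq_cond; elim/big_ind: _ => [|x y|d].
- by left.
- by rewrite /maxn; case: ifP.
- by rewrite -dvdn_divisors //; right.
Qed.
End CyclicGroups.

Theorem theorem5 (n k : nat) (hn : 2 <= n) (hk : 2 <= k)
  (hf : ((f (n %/ q n k))%:Z
           <= Num.min (pdiv n)%:Z (2 * Num.ceil (n%:Q / k%:Q) - 3))%R) :
  Phi k n = f (n %/ q n k).
Proof.
have k0 : 0 < k by exact: ltnW.
have /andP[qn qk] : (q n k %| n) && (q n k <= k) by rewrite q_dvdn_leq // ltnW.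
apply/eqP; rewrite eqn_leq Phi_upper //=.
have [A cA ->] := Phi_attained n k0.
have [i nAk] := coloring_large_class hn k0 cA.
apply: leq_trans (leq_bigmax i).
have ceil_le : (Num.ceil (n%:Q / k%:Q) <= #|A i|%:Z)%R.
  rewrite Num.Theory.ceil_le_int ler_pdivrMr ?ltr0n //.
  by rewrite -[leRHS]intrM ler_int.
move: hf; rewrite le_min => /andP[fp f2].
have {}fp : f (n %/ q n k) <= pdiv n by [].
have {}f2 : f (n %/ q n k) + 3 <= #|A i|.*2.
  by move: f2 ceil_le; lia.
have := @restricted_sumset_lower n (A i) hn.
have : 1 < #|A i| -> 0 < #|restricted_sumset (A i)|.
  exact: (@restricted_product_gt0 'Z_n).
(* If [f] is 1, then [f2] gives [|A i| >= 2] and one sum suffices; from quotient 3 on, [fp] forces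
   [pdiv n >= 3] and the lower bound applies. *)
move: fp f2; case: (n %/ q n k) => [|[|[|t]]] //=; lia.
Qed.
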